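(* Let $H$ be a graph with vertex set $\{v_1,\dots,v_{n(H)}\}$, let $\mathcal{X}=\{X_i:1\le i\le n(H)\}$ be a family of graphs, each with at least one vertex, and let $G=H\circ\mathcal{X}$. Then $G$ is a König–Egerváry graph if and only if each $X_i$ is a König–Egerváry graph without a perfect matching.
   Context: All graphs are finite, simple and undirected. $n(G)$ is the number of vertices, $\alpha(G)$ the independence number and $\mu(G)$ the maximum matching size of $G$. A graph $G$ is König–Egerváry if $\alpha(G)+\mu(G)=n(G)$. The corona $H\circ\mathcal{X}$ is obtained from the disjoint union of $H$ and $X_1,\dots,X_{n(H)}$ by joining each vertex $v_i$ of $H$ to all vertices of $X_i$. *)

(* Defs.v *)
From mathcomp Require Import all_boot.

Set Implicit Arguments.
Unset Strict Implicit.
Unset Printing Implicit Defensive.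

Record sgraph := SGraph {
  vertex :> finType;
  adj : rel vertex;
  adj_sym : symmetric adj;
  adj_irr : irreflexive adj
}.

Section Invariants.
Variable G : sgraph.

Definition n_vertices : nat := #|G|.

Definition independent (S : {set G}) : bool :=
  [forall x in S, forall y in S, ~~ adj x y].

Definition alpha : nat := \max_(S : {set G} | independent S) #|S|.

Definition edges : {set {set G}} :=
  [set [set p.1; p.2] | p : G * G & adj p.1 p.2].

Definition matching (M : {set {set G}}) : bool :=
  (M \subset edges) && trivIset M.

Definition mu : nat := \max_(M : {set {set G}} | matching M) #|M|.

Definition perfect_matching (M : {set {set G}}) : bool :=
  matching M && (cover M == [set: G]).

Definition has_perfect_matching : Prop := exists M, perfect_matching M.

Definition konig_egervary : Prop := alpha + mu = n_vertices.

End Invariants.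

Section Corona.
Variables (H : sgraph) (X : H -> sgraph).

(* [inr (existT _ v x)] is the vertex x of X v. *)
Definition corona_vertex : finType := (H + {v : H & X v})%type.

Definition corona_adj : rel corona_vertex := fun a b =>
  match a, b with
  | inl u, inl v => adj u v
  | inl u, inr q => u == tag q
  | inr p, inl v => tag p == v
  | inr p, inr q => (tag p == tag q) && adj (tagged p) (tagged_as p q)
  end.

Lemma corona_adj_sym : symmetric corona_adj.
Proof.
move=> [u|[u x]] [v|[v y]] //=; first exact: adj_sym.
rewrite [in RHS]eq_sym; have [uv|//] := eqVneq u v.
by subst v; rewrite /= !tagged_asE adj_sym.
Qed.

Lemma corona_adj_irr : irreflexive corona_adj.
Proof.
move=> [u|[u x]] /=; first exact: adj_irr.
by rewrite eqxx tagged_asE adj_irr.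
Qed.

Definition corona : sgraph := SGraph corona_adj_sym corona_adj_irr.

End Corona.

(* Main.v *)
Require Import Defs.
From mathcomp Require Import all_boot zify.

Set Implicit Arguments.
Unset Strict Implicit.
Unset Printing Implicit Defensive.

(** Each edge of a matching has an endpoint outside a given independent set
    [S], and these endpoints are distinct.  Hence [alpha + mu <= n], and [G] is
    König–Egerváry iff, for a maximum independent set [S], the complement of [S]
    can be matched injectively into [S].  A König–Egerváry graph has no perfect
    matching iff [mu < alpha], i.e. iff such an injection misses a vertex of [S].

    In the corona, the union [S] of maximum independent sets of the [X v] is a
    maximum independent set.  The neighbours in [S] of [v] and of the vertices of
    [X v] all lie in [X v], so an injection for the corona amounts to one
    injection for each [X v] together with a missed vertex serving as the mate
    of [v]. *)

(** * Independent sets and matchings in a single graph *)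

Section Matchings.
Variable G : sgraph.
Implicit Types (S : {set G}) (M : {set {set G}}).

Lemma adj_neq (x y : G) : adj x y -> x != y.
Proof. by apply: contraTneq => ->; rewrite adj_irr. Qed.

Lemma edgesP (e : {set G}) :
  reflect (exists x y, adj x y /\ e = [set x; y]) (e \in edges G).
Proof.
apply: (iffP imsetP) => [[[x y] /=]|[x [y [xy ->]]]].
  by rewrite inE /= => xy ->; exists x, y.
by exists (x, y); rewrite ?inE.
Qed.

Lemma independentP S :
  reflect {in S &, forall x y, ~~ adj x y} (independent S).
Proof.
apply: (iffP forall_inP) => [indS x y xS yS|indS x xS].
  by move/forall_inP: (indS x xS); apply.
by apply/forall_inP => y yS; apply: indS.
Qed.

Lemma independent0 : independent (set0 : {set G}).
Proof. by apply/independentP => x y; rewrite inE. Qed.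

Lemma independent1 (x : G) : independent [set x].
Proof. by apply/independentP => y z /set1P-> /set1P->; rewrite adj_irr. Qed.

Lemma matching0 : matching (set0 : {set {set G}}).
Proof.
by rewrite /matching sub0set; apply/trivIsetP => A B; rewrite inE.
Qed.

Lemma leq_alpha S : independent S -> #|S| <= alpha G.
Proof. by move=> indS; apply: (bigmax_sup S). Qed.

Lemma leq_mu M : matching M -> #|M| <= mu G.
Proof. by move=> matM; apply: (bigmax_sup M). Qed.

Lemma alpha_attained : exists2 S : {set G}, independent S & #|S| = alpha G.
Proof.
have [|S indS eqS] := @eq_bigmax_cond _ (@independent G) (fun S => #|S|).
  by apply/card_gt0P; exists set0; apply: independent0.
by exists S; rewrite // /alpha eqS.
Qed.

Lemma mu_attained : exists2 M : {set {set G}}, matching M & #|M| = mu G.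
Proof.
have [|M matM eqM] := @eq_bigmax_cond _ (@matching G) (fun M => #|M|).
  by apply/card_gt0P; exists set0; apply: matching0.
by exists M; rewrite // /mu eqM.
Qed.

Lemma matching_edge_eq M e e' x :
  matching M -> e \in M -> e' \in M -> x \in e -> x \in e' -> e = e'.
Proof.
case/andP=> _ /trivIsetP tM eM e'M xe xe'.
apply/eqP/negPn/negP => /(tM _ _ eM e'M).
by move/disjointFr => /(_ x xe); rewrite xe'.
Qed.

Lemma card_cover_matching M : matching M -> #|cover M| = 2 * #|M|.
Proof.
case/andP=> /subsetP sM /eqP <-; rewrite mulnC -sum_nat_const.
apply: eq_bigr => e /sM /edgesP[x [y [xy ->]]].
by rewrite cards2 (adj_neq xy).
Qed.

(** A matching [M] covers exactly [2 * #|M|] vertices, so a maximum one covers everything as soon as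
    [2 * mu G] reaches the order of [G]. *)
Lemma has_perfect_matchingP : has_perfect_matching G <-> n_vertices G <= 2 * mu G.
Proof.
split=> [[M /andP[matM /eqP cM]]|le_n].
  have := card_cover_matching matM; rewrite cM cardsT /n_vertices => ->.
  by rewrite leq_mul2l leq_mu.
have [M matM cardM] := mu_attained; exists M.
by rewrite /perfect_matching matM eqEcard subsetT cardsT card_cover_matching ?cardM.
Qed.


(** Encodes a matching that saturates the complement of [S] by edges crossing into [S]: [f] gives
    the mates, and its values on [S] are arbitrary. *)
Definition matches_into S (f : G -> G) :=
  [/\ {in ~: S, forall x, f x \in S}, {in ~: S, forall x, adj x (f x)}
    & {in ~: S &, injective f}].

Lemma matching_transversal (x0 : G) S M : independent S -> matching M ->
  exists g : {set G} -> G,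
    {in M, forall e, g e \in e :\: S} /\ {in M &, injective g}.
Proof.
move=> /independentP indS matM.
(* The default [x0] only makes [g] total: on edges of [M] the [pick] succeeds, because an edge
   inside [S] would contradict independence. *)
pose g (e : {set G}) := odflt x0 [pick x in e :\: S].
have gP : {in M, forall e, g e \in e :\: S}.
  move=> e eM; rewrite /g; case: pickP => //= e0; exfalso.
  case/andP: matM => /subsetP/(_ e eM)/edgesP[x [y [xy def_e]]] _.
  have xS : x \in S by have := e0 x; rewrite def_e !inE eqxx /= andbT => /negbFE.
  have yS : y \in S by have := e0 y; rewrite def_e !inE eqxx orbT andbT => /negbFE.
  by have := indS x y xS yS; rewrite xy.
exists g; split=> // e e' eM e'M eq_g.
have /setDP[ge _] := gP e eM; have /setDP[ge' _] := gP e' e'M.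
by apply: (matching_edge_eq matM eM e'M ge); rewrite eq_g.
Qed.

Lemma card_matching_independent S M :
  independent S -> matching M -> #|S| + #|M| <= #|G|.
Proof.
move=> indS matM; rewrite -(cardsC S) leq_add2l.
have [->|[e eM]] := set_0Vmem M; first by rewrite cards0.
have [x0 _] : exists x0 : G, x0 \in e.
  case/andP: matM => /subsetP/(_ e eM)/edgesP[x [y [_ ->]]] _.
  by exists x; rewrite !inE eqxx.
have [g [gP g_inj]] := matching_transversal x0 indS matM.
rewrite -(card_in_imset g_inj); apply/subset_leq_card/subsetP => _ /imsetP[e' e'M ->].
by have /setDP[] := gP e' e'M; rewrite inE.
Qed.

Lemma alpha_add_mu_leq : alpha G + mu G <= n_vertices G.
Proof.
have [S indS <-] := alpha_attained; have [M matM <-] := mu_attained.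
exact: card_matching_independent.
Qed.

Lemma matches_into_mu S f : matches_into S f -> #|~: S| <= mu G.
Proof.
case=> fS fadj f_inj; pose edge x := [set x; f x].
(* A common vertex [z] is either outside [S], hence equal to both [x] and [y], or inside [S], hence
   equal to both [f x] and [f y]. *)
have edge_eq x y z : x \in ~: S -> y \in ~: S -> z \in edge x -> z \in edge y -> x = y.
  move=> xS yS; have := fS x xS; have := fS y yS; move: (xS) (yS); rewrite !inE.
  move=> nxS nyS fyS fxS /orP[]/eqP-> /orP[]/eqP// eq_xy.
  - by rewrite eq_xy fyS in nxS.
  - by rewrite -eq_xy fxS in nyS.
  - exact: f_inj.
have edge_inj : {in ~: S &, injective edge}.
  by move=> x y xS yS eq_e; apply: (edge_eq x y x) => //; rewrite -?eq_e !inE eqxx.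
rewrite -(card_in_imset edge_inj); apply: leq_mu; apply/andP; split.
  apply/subsetP => _ /imsetP[x xS ->]; apply/edgesP.
  by exists x, (f x); split; [apply: fadj|].
apply/trivIsetP => _ _ /imsetP[x xS ->] /imsetP[y yS ->] neq.
rewrite -setI_eq0; apply/eqP/setP => z; rewrite in_set0; apply/negP => /setIP[zx zy].
by move/eqP: neq; apply; rewrite (edge_eq x y z).
Qed.

(** Both inequalities in [#|S| + #|~: S| <= alpha G + mu G <= n_vertices G] are equalities, since
    the two ends agree. *)
Lemma matches_into_konig_egervary S f :
  independent S -> matches_into S f -> konig_egervary G /\ #|S| = alpha G.
Proof.
move=> /leq_alpha indS /matches_into_mu fS; have := alpha_add_mu_leq.
by rewrite /konig_egervary /n_vertices; have := cardsC S; lia.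
Qed.

Lemma konig_egervary_matches_into S :
  konig_egervary G -> independent S -> #|S| = alpha G ->
  exists f, matches_into S f.
Proof.
move=> keG indS cardS; have [M matM cardM] := mu_attained.
have [S0|[x0 _]] := set_0Vmem (~: S).
  by exists id; split=> x; rewrite S0 inE.
have [g [gP g_inj]] := matching_transversal x0 indS matM.
(* Here [#|M| = mu G = #|~: S|], so the injective transversal [g] is onto the complement of [S]. *)
have gM : g @: M = ~: S.
  apply/eqP; rewrite eqEcard; apply/andP; split.
    apply/subsetP => _ /imsetP[e eM ->].
    by have /setDP[] := gP e eM; rewrite inE.
  rewrite card_in_imset // cardM; move: keG; rewrite /konig_egervary /n_vertices.
  by have := cardsC S; lia.
(* The membership premise sits under the existential so that [fin_all_exists] yields a function on
   all of [G]. *)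
have mate x : exists y, x \in ~: S ->
    exists2 e, e \in M & [/\ x = g e, adj x y, y \in S & y \in e].
  have [|_] := boolP (x \in ~: S); last by exists x.
  rewrite -{1}gM => /imsetP[e eM def_x].
  have /setDP[] := gP e eM; rewrite -def_x => xe xS.
  have [y xy ye] : exists2 y, adj x y & y \in e.
    case/andP: matM => /subsetP/(_ e eM)/edgesP[u [v [uv def_e]]] _.
    move: xe; rewrite def_e => /set2P[]->; first by exists v; rewrite ?set22.
    by exists u; rewrite ?set21 // adj_sym.
  (* If the other end [y] were outside [S], it would be [g e'] for some [e'] in [M]; sharing [y]
     forces [e' = e], so [x = y], although they are adjacent. *)
  exists y => _; exists e => //; split=> //; apply/negPn/negP => yS.
  have : y \in g @: M by rewrite gM inE.
  case/imsetP => e' e'M def_y; have /setDP[] := gP e' e'M; rewrite -def_y => ye' _.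
  have eq_e := matching_edge_eq matM eM e'M ye ye'.
  by move/adj_neq: xy; rewrite def_x def_y eq_e eqxx.
have [f fP] := fin_all_exists mate.
exists f; split=> [x /fP[e _ []]//|x /fP[e _ []]//|x y /fP[e eM [-> _ _ fe]]].
move=> /fP[e' e'M [-> _ _ fe']] eq_f.
by congr g; apply: (matching_edge_eq matM eM e'M fe); rewrite eq_f.
Qed.

(** When [alpha G + mu G] is the order of [G], having order at most [2 * mu G] amounts to
    [alpha G <= mu G]. *)
Lemma konig_egervary_no_perfect_matching :
  konig_egervary G -> ~ has_perfect_matching G <-> mu G < alpha G.
Proof.
rewrite /konig_egervary => keG.
split=> [noP|lt_mu /has_perfect_matchingP]; last by lia.
by rewrite ltnNge; apply/negP => le_mu; apply/noP/has_perfect_matchingP; lia.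
Qed.

End Matchings.

(** * Independent sets of the corona *)

Section CoronaSets.
Variables (H : sgraph) (X : H -> sgraph).

Definition corona_inner (v : H) (x : X v) : corona X := inr (existT _ v x).

Definition corona_union (S : forall v, {set X v}) : {set corona X} :=
  [set a : corona X | if a is inr p then tagged p \in S (tag p) else false].

Lemma corona_inner_inj v : injective (@corona_inner v).
Proof. by move=> x y [] /eqP; rewrite eq_Tagged => /eqP. Qed.

Lemma adj_corona_inner v (x y : X v) :
  @adj (corona X) (corona_inner x) (corona_inner y) = adj x y.
Proof. by rewrite /= eqxx tagged_asE. Qed.

Lemma in_corona_union S v (x : X v) :
  (corona_inner x \in corona_union S) = (x \in S v).
Proof. by rewrite inE. Qed.

(** Splits the corona into blocks, each made of [v] and its copy of [X v], so that sizes can be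
    bounded block by block. *)
Lemma card_corona_set (S : {set corona X}) :
  #|S| = \sum_v ((inl v \in S) + #|corona_inner (v := v) @^-1: S|).
Proof.
rewrite -sum1_card big_sumType big_split /=; congr (_ + _).
  by rewrite big_mkcond; apply: eq_bigr => v _; case: (_ \in _).
rewrite [RHS](eq_bigr (fun v => \sum_(x : X v | corona_inner x \in S) 1)).
  by rewrite sig_big_dep; apply: eq_bigl => -[].
by move=> v _; rewrite -sum1_card; apply: eq_bigl => x; rewrite inE.
Qed.

Lemma card_corona_union S : #|corona_union S| = \sum_v #|S v|.
Proof.
rewrite card_corona_set; apply: eq_bigr => v _; rewrite inE add0n.
by apply: eq_card => x; rewrite !inE.
Qed.

Lemma independent_corona_union S :
  (forall v, independent (S v)) -> independent (corona_union S).
Proof.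
move=> indS; apply/independentP => -[u|[v x]] [w|[w y]]; rewrite !inE //= => xS yS.
apply/negP => /andP[/eqP eq_vw]; subst w; rewrite tagged_asE.
by apply/negP; have /independentP := indS v; apply.
Qed.

(** An independent set containing [v] avoids the copy of [X v], so its block contributes 1, which is
    at most [alpha (X v)] as [X v] is nonempty. Otherwise the block contributes an independent set
    of [X v]. *)
Lemma alpha_corona : (forall v, 0 < n_vertices (X v)) ->
  alpha (corona X) = \sum_v alpha (X v).
Proof.
move=> X_nonempty; apply/eqP; rewrite eqn_leq; apply/andP; split.
  have [S /independentP indS <-] := alpha_attained (corona X).
  rewrite card_corona_set; apply: leq_sum => v _.
  have [vS|_] := boolP (inl v \in S); last first.
    rewrite add0n; apply/leq_alpha/independentP => x y; rewrite !inE => xS yS.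
    by rewrite -adj_corona_inner indS.
  rewrite (_ : _ @^-1: S = set0) ?cards0; last first.
    apply/setP => x; rewrite !inE; apply/negP => xS.
    by have := indS _ _ vS xS; rewrite /= eqxx.
  have /card_gt0P[x _] := X_nonempty v.
  by have := leq_alpha (independent1 x); rewrite cards1.
have [S indS cardS] := fin_all_exists2 (fun v => alpha_attained (X v)).
rewrite -(eq_bigr _ (fun v _ => cardS v)) -card_corona_union.
exact/leq_alpha/independent_corona_union.
Qed.

End CoronaSets.

(** * Passing between injections for the corona and for the graphs [X v] *)

Theorem theorem2p2 (H : sgraph) (X : H -> sgraph)
  (X_nonempty : forall v : H, 0 < n_vertices (X v)) :
  konig_egervary (corona X) <->
  (forall v : H, konig_egervary (X v) /\ ~ has_perfect_matching (X v)).
Proof.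
have [S indS cardS] := fin_all_exists2 (fun v => alpha_attained (X v)).
have indU := independent_corona_union indS.
split=> [keG v | keX].
  have cardU : #|corona_union S| = alpha (corona X).
    by rewrite card_corona_union alpha_corona //; apply: eq_bigr.
  have [F [FS Fadj F_inj]] := konig_egervary_matches_into keG indU cardU.
  have outv : inl v \in ~: corona_union S by rewrite !inE.
  have outx (x : X v) : (corona_inner x \in ~: corona_union S) = (x \in ~: S v).
    by rewrite !in_setC in_corona_union.
  (* The union contains no vertex of [H], so the mate of [v] must lie in the copy of [X v]. *)
  have [x0 Fv] : exists x0 : X v, F (inl v) = corona_inner x0.
    have := FS _ outv; have := Fadj _ outv.
    case: (F _) => [w|[w y]] /=; first by rewrite inE.
    by move=> /eqP eq_vw _; subst w; exists y.
  have mate (x : X v) : exists y : X v,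
    x \in ~: S v -> F (corona_inner x) = corona_inner y.
    have [|_] := boolP (x \in ~: S v); last by exists x.
    rewrite -outx => xS; have := FS _ xS; have := Fadj _ xS.
    case: (F _) => [w|[w y]] /=; first by rewrite inE.
    by move=> /andP[/eqP eq_vw _] _; subst w; exists y.
  have [f fP] := fin_all_exists mate.
  have f_into : matches_into (S v) f.
    split=> [x xS|x xS|x y xS yS eq_f].
    - by rewrite -in_corona_union -fP // FS ?outx.
    - by rewrite -adj_corona_inner -fP // Fadj ?outx.
    - apply: (@corona_inner_inj _ X v); apply: F_inj; rewrite ?outx //.
      by rewrite !fP // eq_f.
  have [keX _] := matches_into_konig_egervary (indS v) f_into.
  split=> //; apply/konig_egervary_no_perfect_matching => //.
  case: f_into => fS _ f_inj.
  have x0S : x0 \in S v by rewrite -in_corona_union -Fv FS.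
  (* By injectivity of [F], the mate [x0] of [v] is missed by [f], which makes the image a proper
     subset of [S v]. *)
  have lt_card : #|f @: (~: S v)| < #|S v|.
    apply/proper_card/properP; split.
      by apply/subsetP => _ /imsetP[x xS ->]; apply: fS.
    exists x0 => //; apply/imsetP => -[x xS def_x0].
    have : inl v = corona_inner x by apply: F_inj; rewrite ?outx // Fv fP // def_x0.
    by [].
  move: lt_card keX; rewrite card_in_imset // /konig_egervary /n_vertices.
  by have := cardsC (S v); rewrite cardS; lia.
have [f fP] := fin_all_exists
  (fun v => konig_egervary_matches_into (proj1 (keX v)) (indS v) (cardS v)).
(* The image has at most [#|~: S v| = mu (X v)] elements, fewer than [alpha (X v) = #|S v|]. *)
have free v : exists2 x, x \in S v & x \notin f v @: (~: S v).
  have [ke /(konig_egervary_no_perfect_matching ke) lt_mu] := keX v.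
  apply/subsetPn; apply/negP => /subset_leq_card.
  move: ke (leq_imset_card (f v) (~: S v)); rewrite /konig_egervary /n_vertices.
  by have := cardsC (S v); rewrite cardS; lia.
have [m mS mf] := fin_all_exists2 free.
pose F (a : corona X) : corona X :=
  match a with
  | inl v => corona_inner (m v)
  | inr p => corona_inner (f (tag p) (tagged p))
  end.
suff F_into : matches_into (corona_union S) F.
  by have [] := matches_into_konig_egervary indU F_into.
split=> [[v|[v x]]|[v|[v x]]|[v|[v x]] [w|[w y]]]; rewrite !inE //=;
  have [fS fadj f_inj] := fP v.
- by move=> xS; apply: fS; rewrite inE.
- by move=> xS; rewrite eqxx tagged_asE fadj ?inE.
- by move=> _ _ /(congr1 (fun a : corona X => if a is inr p then tag p else v)) /= ->.
(* Equal values of [F] lie in the same copy; if [v] and a vertex of [X v] shared a mate, [m v] would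
   be in the image of [f v]. *)
- move=> _ yS eq_F; have eq_vw : v = w by case: eq_F.
  subst w; move/corona_inner_inj: eq_F => def_m.
  by have := mf v; rewrite def_m imset_f ?inE.
- move=> xS _ eq_F; have eq_vw : v = w by case: eq_F.
  subst w; move/corona_inner_inj: eq_F => def_m.
  by have := mf v; rewrite -def_m imset_f ?inE.
- move=> xS yS eq_F; have eq_vw : v = w by case: eq_F.
  subst w; move/corona_inner_inj: eq_F => /f_inj eq_xy.
  by rewrite eq_xy ?inE.
Qed.
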